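(* Let $S_1,S_2:[0,1]^2\to[0,1]$ be continuous cancellative t-subnorms with additive generators $s_1:[0,1]\to[s_1(1),\infty]$ and $s_2:[0,1]\to[s_2(1),\infty]$, respectively. Then $S_1\le S_2$ (i.e. $S_1(x,y)\le S_2(x,y)$ for all $(x,y)\in[0,1]^2$) if and only if the function $s_1\circ s_2^{-1}:[s_2(1),\infty]\to[s_1(1),\infty]$ is subadditive, i.e. $$s_1\circ s_2^{-1}(u+v)\le s_1\circ s_2^{-1}(u)+s_1\circ s_2^{-1}(v)$$ for all $u,v\in[s_2(1),\infty]$.
   Context: A t-subnorm is a binary operation $S:[0,1]^2\to[0,1]$ that is commutative, associative, non-decreasing in both variables and satisfies $S(x,y)\le\min(x,y)$ for all $x,y$. It is cancellative if $S(x,y)=S(x,z)$ with $x>0$ implies $y=z$. By a known representation theorem, a t-subnorm $S$ is continuous and cancellative if and only if there is a continuous, strictly decreasing function $s:[0,1]\to[0,\infty]$ with $s(0)=\infty$ such that $S(x,y)=s^{-1}(s(x)+s(y))$ for all $x,y\in[0,1]$, where $s$ is viewed as a (strictly decreasing) bijection $[0,1]\to[s(1),\infty]$ with inverse $s^{-1}:[s(1),\infty]\to[0,1]$. Such an $s$ is called an additive generator of $S$; it is unique up to a positive multiplicative constant. Usual conventions on $[0,\infty]$ apply: $a+\infty=\infty$. *)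

(* Defs.v *)
From HB Require Import structures.
From mathcomp Require Import all_boot all_order all_algebra.
From mathcomp Require Import all_classical all_reals all_analysis.
Import Order.TTheory GRing.Theory Num.Theory.
Import numFieldNormedType.Exports.

Set Implicit Arguments.
Unset Strict Implicit.
Unset Printing Implicit Defensive.

Local Open Scope classical_set_scope.
Local Open Scope ring_scope.

(* Operations on [0,1] and generators [0,1] -> [0,oo] are total functions on R
   of which only the restriction to [0,1] is ever constrained or used. *)

Record tsubnorm (R : realType) (S : R -> R -> R) : Prop := Tsubnorm {
  tsubnorm_closed : forall x y, x \in `[0, 1] -> y \in `[0, 1] ->
    S x y \in `[0, 1];
  tsubnormC : forall x y, x \in `[0, 1] -> y \in `[0, 1] -> S x y = S y x;
  tsubnormA : forall x y z, x \in `[0, 1] -> y \in `[0, 1] -> z \in `[0, 1] ->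
    S x (S y z) = S (S x y) z;
  tsubnorm_homo : forall x x' y y',
    x \in `[0, 1] -> x' \in `[0, 1] -> y \in `[0, 1] -> y' \in `[0, 1] ->
    x <= x' -> y <= y' -> S x y <= S x' y';
  tsubnorm_le_min : forall x y, x \in `[0, 1] -> y \in `[0, 1] ->
    S x y <= Num.min x y
}.

Definition cancellative (R : realType) (S : R -> R -> R) : Prop :=
  forall x y z, x \in `[0, 1] -> y \in `[0, 1] -> z \in `[0, 1] ->
    0 < x -> S x y = S x z -> y = z.

Definition continuous_op (R : realType) (S : R -> R -> R) : Prop :=
  {within `[0, 1]%classic `*` `[0, 1]%classic,
    continuous (fun p : R * R => S p.1 p.2)}.

(* The inverse of s on the image of [0,1]; when s is a generator this image is
   [s 1, +oo]. Elsewhere the value is irrelevant. *)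
Definition gen_inv (R : realType) (s : R -> \bar R) : \bar R -> R :=
  'pinv_(fun=> 0) `[0, 1]%classic s.

Record additive_generator (R : realType) (S : R -> R -> R) (s : R -> \bar R)
    : Prop := AdditiveGenerator {
  generator_ge0 : forall x, x \in `[0, 1] -> (0 <= s x)%E;
  generator_continuous : {within `[0, 1]%classic, continuous s};
  generator_decr : forall x y, x \in `[0, 1] -> y \in `[0, 1] ->
    x < y -> (s y < s x)%E;
  generator0 : s 0 = +oo%E;
  generatorE : forall x y, x \in `[0, 1] -> y \in `[0, 1] ->
    S x y = gen_inv s (s x + s y)%E
}.

Definition subadditive_on (R : realType) (D : set (\bar R))
    (f : \bar R -> \bar R) : Prop :=
  forall u v, D u -> D v -> (f (u + v) <= f u + f v)%E.

(* Main.v *)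
(* Since s1 is decreasing, S1 x y <= S2 x y says exactly that
   s1 (s2^-1 (s2 x + s2 y)) <= s1 x + s1 y. Substituting u = s2 x, v = s2 y,
   which range over all of [s2 1, +oo] because s2 is onto, gives
   subadditivity. *)
Require Import Defs.
From mathcomp Require Import all_boot all_order all_algebra.
From mathcomp Require Import all_classical all_reals all_analysis.
Local Open Scope classical_set_scope.
Local Open Scope ring_scope.
Import Order.TTheory GRing.Theory Num.Theory.

Section Generator.
Set Implicit Arguments.
Unset Strict Implicit.
Context {R : realType} {S : R -> R -> R} {s : R -> \bar R}.
Context (gs : additive_generator S s).

Let mem0 : (0 : R) \in `[0, 1]. Proof. by rewrite in_itv /= lexx ler01. Qed.
Let mem1 : (1 : R) \in `[0, 1]. Proof. by rewrite in_itv /= lexx ler01. Qed.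

(** Strict decrease on a total order reverses [<=] in both directions; the boolean equality allows
    rewriting either way. *)
Lemma generator_le x y : x \in `[0, 1] -> y \in `[0, 1] ->
  (s x <= s y)%E = (y <= x).
Proof.
move=> xI yI; case: (ltgtP x y) => [xy|yx|->]; last by rewrite lexx.
- by rewrite leNgt (generator_decr gs).
- by rewrite ltW// (generator_decr gs).
Qed.

Lemma generator_inj : {in `[0, 1]%classic &, injective s}.
Proof.
move=> x y; rewrite !inE => xI yI /= sxy.
by apply/eqP; rewrite eq_le -!generator_le// sxy lexx.
Qed.

Lemma generatorK x : x \in `[0, 1] -> gen_inv s (s x) = x.
Proof. by move=> xI; apply: (pinvKV _ generator_inj); rewrite inE. Qed.

(* The image of the connected set [0, 1] is connected, hence has no gap. *)
Lemma generator_surj u : (s 1 <= u)%E -> exists2 x, x \in `[0, 1] & s x = u.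
Proof.
move=> s1u; apply: contrapT => nu.
have nus x : x \in `[0, 1] -> s x != u.
  by move=> xI; apply/eqP => sxu; apply: nu; exists x.
have cI : connected (s @` `[0, 1]%classic).
  apply: connected_continuous_connected (generator_continuous gs).
  exact: segment_connected.
(* If every value of [s] were below [u], so would be [s 0 = +oo], which is absurd. Connectedness
   forces this once the values below [u] are nonempty, open and closed in the image. *)
suff : s @` `[0, 1]%classic `&` [set y | (y < u)%E] = s @` `[0, 1]%classic.
  move=> /seteqP[_ /(_ (s 0))] []; first by exists 0.
  by rewrite /= (generator0 gs) ltNge leey.
apply: cI.
- by exists (s 1); split; [exists 1 | rewrite /= lt_neqAle nus].
- by exists [set y | (y < u)%E] => //; exact: open_ereal_lt_ereal.
(* As [u] is not attained, [<] and [<=] cut out the same part of the image. *)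
- exists [set y | (y <= u)%E]; first exact: closed_ereal_ge_ereal.
  apply/seteqP; split=> _ [[x xI <-]] /= h; split; try by exists x.
    exact: ltW.
  by rewrite lt_neqAle nus.
Qed.

Lemma gen_inv_in u : (s 1 <= u)%E -> gen_inv s u \in `[0, 1].
Proof. by case/generator_surj => x xI <-; rewrite generatorK. Qed.

Lemma gen_invK u : (s 1 <= u)%E -> s (gen_inv s u) = u.
Proof. by case/generator_surj => x xI <-; rewrite generatorK. Qed.

Lemma generator_ge1 x : x \in `[0, 1] -> (s 1 <= s x)%E.
Proof. by move=> xI; rewrite generator_le//; case/andP: xI. Qed.

(** Since [s y] is nonnegative, [s x + s y] stays in [[s 1, +oo]], where [gen_inv s] is a right
    inverse of [s]. *)
Lemma generatorD x y : x \in `[0, 1] -> y \in `[0, 1] ->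
  s (S x y) = (s x + s y)%E.
Proof.
move=> xI yI; rewrite (generatorE gs)// gen_invK//.
by rewrite (le_trans (generator_ge1 xI))// leeDl// (generator_ge0 gs).
Qed.

End Generator.

Theorem theorem3p1 (R : realType) (S1 S2 : R -> R -> R) (s1 s2 : R -> \bar R)
    (tS1 : tsubnorm S1) (cS1 : continuous_op S1) (kS1 : cancellative S1)
    (tS2 : tsubnorm S2) (cS2 : continuous_op S2) (kS2 : cancellative S2)
    (gs1 : additive_generator S1 s1) (gs2 : additive_generator S2 s2) :
  (forall x y : R, x \in `[0, 1] -> y \in `[0, 1] -> S1 x y <= S2 x y) <->
  subadditive_on [set u : \bar R | (s2 1%R <= u)%E] (s1 \o gen_inv s2).
Proof.
have key x y : x \in `[0, 1] -> y \in `[0, 1] ->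
    (S1 x y <= S2 x y) = (s1 (gen_inv s2 (s2 x + s2 y)) <= s1 x + s1 y)%E.
  (* The right-hand side becomes [s1 (S2 x y) <= s1 (S1 x y)], with both arguments in [[0, 1]],
     where [s1] reverses the order. *)
  move=> xI yI; rewrite -(generatorE gs2)// -(generatorD gs1)//.
  by rewrite (generator_le gs1)// tsubnorm_closed.
split=> [S12 u v /= u1 v1|sub x y xI yI].
- have [xI yI] := (gen_inv_in gs2 u1, gen_inv_in gs2 v1).
  by have := S12 _ _ xI yI; rewrite key// !(gen_invK gs2).
- rewrite key//.
  have := sub _ _ (generator_ge1 gs2 xI) (generator_ge1 gs2 yI).
  by rewrite /= !(generatorK gs2).
Qed.
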